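(* Let $G=(V,E)$ be a finite simple connected graph and let $V_1\subseteq V$. Let $d$ be the shortest-path metric of $G$ restricted to $V_1$ (every edge has length $1$). Then \[\mathcal{P}_G\cap\mathbb{R}^{V_1}=KR(V_1,d),\] where $\mathcal{P}_G\cap\mathbb{R}^{V_1}:=\{x\in\mathcal{P}_G : x_i=0 \text{ for all } i\notin V_1\}$.
   Context: For a graph $G=(V,E)$, the symmetric edge polytope is $\mathcal{P}_G:=\mathrm{conv}\{\mathbf{e}_v-\mathbf{e}_w,\ \mathbf{e}_w-\mathbf{e}_v : \{v,w\}\in E\}\subset\mathbb{R}^V$, where $(\mathbf{e}_v)_{v\in V}$ is the standard basis. For a finite metric space $(X,d)$, the Kantorovich--Rubinstein polytope is $KR(X,d):=\mathrm{conv}\{\frac{\mathbf{e}_i-\mathbf{e}_j}{d(i,j)} : i,j\in X\}\subset\mathbb{R}^X\subseteq\mathbb{R}^V$, where for $i=j$ the point is taken to be the origin $\mathbf{0}$.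
   Formalization: The formal theorem assumes that G has at least two vertices and that V_1 is nonempty; otherwise the equality can fail, since the convex hull of the empty set is empty (e.g. G a single vertex with V_1=V, or V_1 empty and G having an edge). *)

(* Defs.v *)
From mathcomp Require Import all_boot all_order all_algebra.
From mathcomp Require Import boolp classical_sets reals convex.

Set Implicit Arguments.
Unset Strict Implicit.
Unset Printing Implicit Defensive.

Import Order.TTheory GRing.Theory Num.Theory.

Local Open Scope classical_set_scope.
Local Open Scope ring_scope.

Definition conv_hull (R : realType) (E : lmodType R) (A : set E) : set E :=
  smallest (@convex_set R E) A.

Definition basis_vec (R : realType) (V : finType) (v : V) : {ffun V -> R^o} :=
  [ffun w => (w == v)%:R].

Section Graph.
Variables (V : finType) (e : rel V).

Definition connected_graph := forall v w : V, connect e v w.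

Definition has_walk (v w : V) (n : nat) : bool :=
  [exists p : n.-tuple V, path e v p && (last v p == w)].

Lemma connect_has_walk v w : connect e v w -> exists n, has_walk v w n.
Proof.
move=> /connectP[p ep ->]; exists (size p).
by apply/existsP; exists (in_tuple p); rewrite ep eqxx.
Qed.

Definition graph_dist (e_conn : connected_graph) (v w : V) : nat :=
  ex_minn (connect_has_walk (e_conn v w)).

End Graph.

Definition sym_edge_polytope (R : realType) (V : finType) (e : rel V) :
    set {ffun V -> R^o} :=
  conv_hull [set x | exists v w : V, e v w /\
    (x = basis_vec R v - basis_vec R w \/ x = basis_vec R w - basis_vec R v)].

Arguments sym_edge_polytope R {V} e _.

(* [X : {set V}] carries the metric [d], of which only the values on [X] matter;
   R^X is viewed inside R^V. *)
Definition KR_polytope (R : realType) (V : finType) (X : {set V})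
    (d : V -> V -> R) : set {ffun V -> R^o} :=
  conv_hull [set x | exists i j : V, [/\ i \in X, j \in X &
    x = if i == j then 0 else (d i j)^-1 *: (basis_vec R i - basis_vec R j)]].

Arguments KR_polytope {R V} X d _.

(* Main.v *)
Require Import Defs.
From HB Require Import structures.
From mathcomp Require Import all_boot all_order all_algebra.
From mathcomp Require Import interval_inference.
From mathcomp Require Import boolp classical_sets reals convex.
From mathcomp Require Import ring.

(** The convex hull of [A] is the slice at height [1] of the cone spanned by
    [A * {1}], and the part of a cone lying in a hyperplane is spanned by the
    generators in the hyperplane and by the rays where the planar cones on two
    generators cross it. So [conv A] meets a hyperplane in the convex hull of
    the points where the segments between points of [A] do. For the
    Kantorovich-Rubinstein polytope of [X] and the hyperplane [x_k = 0], the
    segments that cross it join [(e_i - e_k) / d(i, k)] to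
    [(e_k - e_j) / d(k, j)], and they do so at
    [(e_i - e_j) / (d(i, k) + d(k, j))], which by the triangle inequality lies
    between [0] and [(e_i - e_j) / d(i, j)]. Hence the section of the polytope
    of [X] is the polytope of [X \ k], and points can be deleted one by one.
    Finally, the polytope of the whole graph is the symmetric edge polytope,
    because [(e_v - e_w) / d(v, w)] is the average of the edge vectors along a
    shortest path from [v] to [w]. *)

Set Implicit Arguments.
Unset Strict Implicit.
Unset Printing Implicit Defensive.

Import Order.TTheory GRing.Theory Num.Theory.

Local Open Scope classical_set_scope.
Local Open Scope ring_scope.

Section ConvexCone.
Variables (R : numDomainType) (E : lmodType R).
Implicit Types (A B K : set E) (x y : E) (l : {scalar E}).

Definition convex_cone K := [/\ K 0, forall x y, K x -> K y -> K (x + y) &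
  forall (c : R) x, 0 <= c -> K x -> K (c *: x)].

Definition cone_hull A : set E := smallest convex_cone A.

Lemma cone_hull_convex_cone A : convex_cone (cone_hull A).
Proof.
split=> [|x y Ax Ay|c x c0 Ax] K [cK AK]; case: (cK) => K0 KD KZ //.
  by apply: KD; [exact: Ax|exact: Ay].
by apply: KZ => //; exact: Ax.
Qed.

Lemma cone_hullU_sub A B :
  cone_hull (A `|` B) `<=` [set y + z | y in cone_hull A & z in cone_hull B].
Proof.
have [A0 AD AZ] := cone_hull_convex_cone A.
have [B0 BD BZ] := cone_hull_convex_cone B.
apply: smallest_sub => [|x [Ax|Bx]]; first split.
- by exists 0 => //; exists 0; rewrite ?addr0.
- move=> _ _ [y Ay [z Bz <-]] [y' Ay' [z' Bz' <-]].
  by exists (y + y'); [|exists (z + z')]; rewrite 1?addrACA; auto.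
- move=> c _ c0 [y Ay [z Bz <-]].
  by exists (c *: y); [|exists (c *: z)]; rewrite ?scalerDr; auto.
- exists x; first exact: sub_gen_smallest.
  by exists 0; rewrite ?addr0.
- exists 0 => //; exists x; rewrite ?add0r //.
  exact: sub_gen_smallest.
Qed.

Lemma cone_hull_face A K l : convex_cone K ->
  (forall a, A a -> 0 <= l a) -> (forall a, A a -> l a = 0 -> K a) ->
  cone_hull A `<=` [set x | 0 <= l x /\ (l x = 0 -> K x)].
Proof.
move=> [K0 KD KZ] lA AK; apply: smallest_sub; last by split; auto.
split=> /= [|x y [lx Kx] [ly Ky]|c x c0 [lx Kx]]; first by rewrite linear0.
  rewrite linearD /=; split=> [|/eqP]; first exact: addr_ge0.
  by rewrite paddr_eq0 // => /andP[/eqP/Kx ? /eqP/Ky ?]; exact: KD.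
rewrite linearZ /=; split=> [|/eqP]; first exact: mulr_ge0.
rewrite mulf_eq0 => /orP[/eqP ->|/eqP/Kx]; first by rewrite scale0r.
exact: KZ.
Qed.

(* Spans the intersection of the plane through [x] and [y] with [l = 0]. *)
Definition crossing l x y : E := l x *: y - l y *: x.

Lemma crossing_opp l x y : crossing l x y = crossing (\- l) y x.
Proof. by rewrite /crossing /= !scaleNr opprK addrC. Qed.

Lemma cone_hull_crossing_r A K l x : convex_cone K ->
  (forall a, A a -> K (crossing l x a)) ->
  forall y, cone_hull A y -> K (crossing l x y).
Proof.
rewrite /crossing => -[K0 KD KZ] AK; apply: smallest_sub => //.
split=> /= [|y z Ky Kz|c y c0 Ky].
- by rewrite !linear0 scale0r subr0.
- by rewrite scalerDr (linearD l) scalerDl opprD addrACA; exact: KD.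
- rewrite [l (_ *: _)]linearZ /= scalerA [l x * c]mulrC -!scalerA -scalerBr.
  exact: KZ.
Qed.

Lemma cone_hull_crossing A B K l : convex_cone K ->
  (forall a b, A a -> B b -> K (crossing l a b)) ->
  forall x y, cone_hull A x -> cone_hull B y -> K (crossing l x y).
Proof.
move=> cK ABK x y Ax; apply: cone_hull_crossing_r => // b Bb.
rewrite crossing_opp; apply: cone_hull_crossing_r Ax => // a Aa.
by rewrite -crossing_opp; exact: ABK.
Qed.

End ConvexCone.

Lemma cone_hull_section (R : realFieldType) (E : lmodType R) (A K : set E)
    (l : {scalar E}) : convex_cone K ->
  (forall a, A a -> l a = 0 -> K a) ->
  (forall a b, A a -> A b -> 0 < l a -> l b < 0 -> K (crossing l a b)) ->
  cone_hull A `&` [set x | l x = 0] `<=` K.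
Proof.
move=> cK AK0 AK x [+ lx0]; have [K0 KD KZ] := cK.
pose P := A `&` [set a | 0 <= l a]; pose N := A `&` [set a | l a <= 0].
have PN_K a b : P a -> N b -> K (crossing l a b).
  rewrite /crossing => -[Aa]; rewrite /= le_eqVlt => /predU1P[/esym la0|la].
    move=> [Ab lb]; rewrite la0 scale0r add0r -scaleNr.
    by apply: KZ; [rewrite oppr_ge0|exact: AK0].
  move=> [Ab]; rewrite /= le_eqVlt => /predU1P[lb0|lb]; last exact: AK.
  by rewrite lb0 scale0r subr0; apply: KZ; [exact: ltW|exact: AK0].
have -> : A = P `|` N.
  by rewrite -setIUr setIidl // => a _; apply/orP; exact: le_total.
move=> /cone_hullU_sub[y Py [z Nz xE]]; rewrite -xE in lx0 *.
have lzE : l z = - l y by apply/eqP; rewrite -addr_eq0 addrC -linearD lx0.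
have [ly_ge0 Ky] : 0 <= l y /\ (l y = 0 -> K y).
  by apply: (cone_hull_face cK) Py => a []; auto.
have [_ Kz] : 0 <= (\- l) z /\ ((\- l) z = 0 -> K z).
  apply: (cone_hull_face cK) Nz => a [Aa /= la]; first by rewrite oppr_ge0.
  by move/eqP; rewrite oppr_eq0 => /eqP; exact: AK0.
have [ly0|ly_neq0] := eqVneq (l y) 0.
  by apply: KD; [exact: Ky|apply: Kz; rewrite /= lzE opprK].
have := cone_hull_crossing cK PN_K Py Nz.
rewrite /crossing lzE scaleNr opprK -scalerDr addrC => /(KZ (l y)^-1).
by rewrite invr_ge0 scalerA mulVf // scale1r; exact.
Qed.

Lemma convex_setP (R : numDomainType) (E : lmodType R) (A : set E) :
  @convex_set R E A <->
  forall x y (s t : R), 0 <= s -> 0 <= t -> s + t = 1 -> A x -> A y ->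
    A (s *: x + t *: y).
Proof.
split=> cA x y; last first.
  move=> t /set_mem Ax /set_mem Ay; apply/mem_set/cA => //.
    by rewrite subr_ge0.
  by rewrite addrC subrK.
move=> s t s0 t0 st1 Ax Ay; have s1 : s <= 1 by rewrite -st1 lerDl.
have /set_mem := cA x y (Itv01 s0 s1) (mem_set Ax) (mem_set Ay).
by rewrite (_ : t = 1 - s) // -st1 addrAC subrr add0r.
Qed.

Definition homogenize (R : pzRingType) (E : lmodType R) (A : set E) :
  set (E * R^o) := [set (a, 1) | a in A].

Lemma convex_set_perspective (R : numFieldType) (E : lmodType R) (C : set E) :
  @convex_set R E C ->
  convex_cone [set p : E * R^o | p = 0 \/ 0 < p.2 /\ C (p.2^-1 *: p.1)].
Proof.
move=> /convex_setP cC; split; first by left.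
- move=> p q [->|[p0 Cp]] [->|[q0 Cq]]; rewrite ?add0r ?addr0;
    [by left|by right|by right|right].
  have pq0 : 0 < p.2 + q.2 by exact: addr_gt0.
  split=> //=.
  have := cC _ _ (p.2 / (p.2 + q.2)) (q.2 / (p.2 + q.2)) _ _ _ Cp Cq.
  rewrite !scalerA mulrAC divff ?gt_eqF // mul1r.
  rewrite mulrAC divff ?gt_eqF // mul1r -scalerDr; apply.
  + by rewrite divr_ge0 // ltW.
  + by rewrite divr_ge0 // ltW.
  + by rewrite -mulrDl divff // gt_eqF.
- move=> c p; rewrite le_eqVlt => /predU1P[<- _|c0].
    by left; rewrite scale0r.
  move=> [->|[p0 Cp]]; first by left; rewrite scaler0.
  right; split=> /=; first exact: mulr_gt0.
  by rewrite invfM scalerA -mulrA mulrCA mulVf ?mulr1 // gt_eqF.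
Qed.

Section ConvexHull.
Variables (R : realType) (E : lmodType R).
Implicit Types (A C : set E) (x : E) (l : {scalar E}).

Lemma conv_hull_convex A : @convex_set R E (conv_hull A).
Proof.
apply/convex_setP => x y s t s0 t0 st1 Ax Ay C [cC AC].
by move/convex_setP: (cC); apply => //; [exact: Ax|exact: Ay].
Qed.

Lemma conv_hull_homogenize A x :
  conv_hull A x <-> cone_hull (homogenize A) (x, 1).
Proof.
have [_ HD HZ] := cone_hull_convex_cone (homogenize A).
split; [move: x; apply: smallest_sub => [|a Aa]|].
- apply/convex_setP => x y s t s0 t0 st1 Hx Hy /=.
  have -> : (s *: x + t *: y, 1) = s *: (x, 1) + t *: (y, 1) :> E * R^o.
    by congr pair; rewrite /= /GRing.scale /= !mulr1.
  by apply: HD; exact: HZ.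
- by apply: sub_gen_smallest; exists a.
move=> /(smallest_sub (convex_set_perspective (@conv_hull_convex A)))[||].
- move=> _ [a Aa <-]; right; rewrite /= invr1 scale1r; split=> //.
  exact: sub_gen_smallest.
- by case=> _ /eqP; rewrite oner_eq0.
- by case=> _; rewrite /= invr1 scale1r.
Qed.

(* The point of the segment from [x] to [y] on [l = 0] if [l y < 0 < l x]. *)
Definition crossing_point l x y : E := (l x - l y)^-1 *: crossing l x y.

Lemma conv_hull_section A C l : @convex_set R E C ->
  (forall a, A a -> l a = 0 -> C a) ->
  (forall a b, A a -> A b -> 0 < l a -> l b < 0 -> C (crossing_point l a b)) ->
  conv_hull A `&` [set x | l x = 0] `<=` C.
Proof.
move=> cC AC0 AC x [/conv_hull_homogenize Ax lx0].
have cH := cone_hull_convex_cone (homogenize C); have [_ _ HZ] := cH.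
suff : cone_hull (homogenize C) (x, 1).
  by move/conv_hull_homogenize; rewrite /conv_hull smallest_id.
apply: (@cone_hull_section _ _ (homogenize A) _ (l \o fst) cH) => //.
- move=> _ [a Aa <-] /= la0; apply: sub_gen_smallest; exists a => //.
  exact: AC0.
- move=> _ _ [a Aa <-] [b Ab <-] /= la lb.
  have lab : 0 < l a - l b by rewrite subr_gt0 (lt_trans lb).
  have -> : crossing (l \o fst) (a, 1) (b, 1) =
      (l a - l b) *: (crossing_point l a b, 1) :> E * R^o.
    congr pair; last by rewrite /= /GRing.scale /= !mulr1.
    by rewrite /= scalerA divff ?scale1r // gt_eqF.
  apply: HZ; first exact: ltW.
  by apply: sub_gen_smallest; exists (crossing_point l a b) => //; exact: AC.
Qed.

End ConvexHull.

Section KantorovichRubinstein.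
Variables (R : realType) (V : finType) (d : V -> V -> R).
Implicit Types (X Y : {set V}) (x : {ffun V -> R^o}).

Local Notation e_ := (basis_vec R).

Definition ffun_eval k x : R := x k.

Fact ffun_eval_is_scalar k : scalar (ffun_eval k).
Proof. by move=> c x y; rewrite /ffun_eval !ffunE. Qed.

HB.instance Definition _ k := GRing.isLinear.Build R {ffun V -> R^o} R _
  (ffun_eval k) (ffun_eval_is_scalar k).

(* Terminology of the theory of Lipschitz-free spaces. *)
Definition molecule i j : {ffun V -> R^o} := (d i j)^-1 *: (e_ i - e_ j).

Lemma molecule_id i : molecule i i = 0.
Proof. by rewrite /molecule subrr scaler0. Qed.

Lemma molecule_eval i j k :
  molecule i j k = (d i j)^-1 * ((k == i)%:R - (k == j)%:R).
Proof. by rewrite !ffunE. Qed.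

Lemma KR_polytopeE X : KR_polytope X d =
  conv_hull [set x | exists i j, [/\ i \in X, j \in X & x = molecule i j]].
Proof.
rewrite /KR_polytope; congr conv_hull; apply/seteqP.
by split=> _ [i [j [iX jX ->]]]; exists i, j; split=> //;
  case: eqVneq => // ->; rewrite molecule_id.
Qed.

Lemma KR_polytope_convex X :
  @convex_set R {ffun V -> R^o} (KR_polytope X d).
Proof. exact: conv_hull_convex. Qed.

Lemma KR_polytope_molecule X i j :
  i \in X -> j \in X -> KR_polytope X d (molecule i j).
Proof.
by move=> iX jX; rewrite KR_polytopeE; apply: sub_gen_smallest; exists i, j.
Qed.

Lemma KR_polytope_sub X (C : set {ffun V -> R^o}) :
  @convex_set R {ffun V -> R^o} C ->
  (forall i j, i \in X -> j \in X -> C (molecule i j)) ->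
  KR_polytope X d `<=` C.
Proof.
move=> cC XC; rewrite KR_polytopeE; apply: smallest_sub => //.
by move=> _ [i [j [iX jX ->]]]; exact: XC.
Qed.

Hypothesis d_gt0 : forall i j, i != j -> 0 < d i j.

Lemma KR_polytope_dist_le X i j (c : R) : i \in X -> j \in X -> d i j <= c ->
  KR_polytope X d (c^-1 *: (e_ i - e_ j)).
Proof.
move=> iX jX dc; have KR0 : KR_polytope X d 0.
  by rewrite -(molecule_id i); exact: KR_polytope_molecule.
have [->|ij] := eqVneq i j; first by rewrite subrr scaler0.
have dij := d_gt0 ij; have c0 := lt_le_trans dij dc.
have /convex_setP cKR := @KR_polytope_convex X.
have := cKR _ _ (d i j / c) (1 - d i j / c) _ _ _
  (KR_polytope_molecule iX jX) KR0.
rewrite scaler0 addr0 scalerA mulrAC divff ?gt_eqF // mul1r; apply.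
- by rewrite divr_ge0 // ltW.
- by rewrite subr_ge0 ler_pdivrMr // mul1r.
- by rewrite addrC subrK.
Qed.

Lemma molecule_eval_eq0 i j k :
  molecule i j k = 0 -> i = j \/ k != i /\ k != j.
Proof.
have [->|ij] := eqVneq i j; first by left.
rewrite molecule_eval => /eqP.
rewrite mulf_eq0 invr_eq0 gt_eqF ?d_gt0 //= subr_eq0 eqr_nat.
have [->|ki] := eqVneq k i; first by rewrite (negPf ij).
by have [//|kj _] := eqVneq k j; right.
Qed.

Lemma molecule_eval_gt0 i j k : 0 < molecule i j k -> i = k /\ k != j.
Proof.
have [->|ij] := eqVneq i j; first by rewrite molecule_id ffunE ltxx.
rewrite molecule_eval pmulr_rgt0 ?invr_gt0 ?d_gt0 // subr_gt0 ltr_nat.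
by have [->|] := eqVneq k i; have [//|] := eqVneq.
Qed.

Lemma molecule_eval_lt0 i j k : molecule i j k < 0 -> j = k /\ i != k.
Proof.
have [->|ij] := eqVneq i j; first by rewrite molecule_id ffunE ltxx.
rewrite molecule_eval pmulr_rlt0 ?invr_gt0 ?d_gt0 // subr_lt0 ltr_nat.
by have [_|ki] := eqVneq k i; have [<-|//] := eqVneq k j; rewrite // eq_sym.
Qed.

Lemma molecule_crossing_point i j k : i != k -> k != j ->
  crossing_point (ffun_eval k) (molecule k j) (molecule i k) =
  (d i k + d k j)^-1 *: (e_ i - e_ j).
Proof.
move=> ik kj; have dik := d_gt0 ik; have dkj := d_gt0 kj.
rewrite /crossing_point /crossing /= /ffun_eval !molecule_eval eqxx.
rewrite (negPf kj) [k == i]eq_sym (negPf ik).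
rewrite subr0 sub0r mulr1 mulrN1 scaleNr !opprK /molecule !scalerA.
rewrite [(d i k)^-1 * _]mulrC -scalerDr addrA subrK scalerA.
by congr (_ *: _); field; rewrite !gt_eqF ?addr_gt0.
Qed.

Hypothesis d_triangle : forall i j k, d i k <= d i j + d j k.

Lemma KR_polytope_setD1 X k : (0 < #|X :\ k|)%N ->
  KR_polytope X d `&` [set x | x k = 0] `<=` KR_polytope (X :\ k) d.
Proof.
move=> /card_gt0P[u uXk]; rewrite [in X in X `<=` _]KR_polytopeE.
apply: (@conv_hull_section _ _ _ _ (ffun_eval k)).
- exact: KR_polytope_convex.
- move=> _ [i [j [iX jX ->]]] /molecule_eval_eq0[->|[ki kj]].
    by rewrite molecule_id -(molecule_id u); exact: KR_polytope_molecule.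
  by apply: KR_polytope_molecule; rewrite !inE eq_sym ?ki ?kj.
- move=> _ _ [k1 [j [_ jX ->]]] [i [k2 [iX _ ->]]].
  move=> /molecule_eval_gt0[-> kj] /molecule_eval_lt0[-> ik].
  rewrite molecule_crossing_point //.
  by apply: KR_polytope_dist_le; rewrite // !inE ?iX ?jX ?ik // eq_sym kj.
Qed.

Lemma KR_polytope_section X Y : Y \subset X -> (0 < #|Y|)%N ->
  [set x | KR_polytope X d x /\ forall i, i \notin Y -> x i = 0] =
  KR_polytope Y d.
Proof.
move=> YX Y0; apply/seteqP; split=> [x [+ x0]|].
  have [n] := ubnP #|X|; elim: n => // n IH in X YX * => ltXn KRx.
  have [->//|XY] := eqVneq Y X.
  have /properP[_ [k kX kY]] : Y \proper X by rewrite finset.properEneq XY.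
  have YXk : Y \subset X :\ k by rewrite subsetD1 YX.
  apply: (IH _ YXk); first by rewrite (cardsD1 k) kX in ltXn.
  apply: KR_polytope_setD1; first exact: leq_trans Y0 (subset_leq_card YXk).
  by split=> //; exact: x0.
apply: KR_polytope_sub => [|i j iY jY]; last split.
- apply/convex_setP => x y s t s0 t0 st1 [KRx x0] [KRy y0]; split.
    by have /convex_setP := @KR_polytope_convex X; apply.
  by move=> i iY; rewrite !ffunE x0 // y0 // !scaler0 addr0.
- by apply: KR_polytope_molecule; exact: (fintype.subsetP YX).
- move=> k kY; have kN l : l \in Y -> (k == l) = false.
    by move=> lY; apply: contraNF kY => /eqP ->.
  by rewrite molecule_eval !kN // subrr mulr0.
Qed.

End KantorovichRubinstein.

Section GraphDistance.
Variables (V : finType) (e : rel V) (e_conn : connected_graph e).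

Lemma shortest_path v w :
  exists p, [/\ path e v p, last v p = w & size p = graph_dist e_conn v w].
Proof.
rewrite /graph_dist; case: ex_minnP => n /existsP[p /andP[ep /eqP lp]] _.
by exists p; rewrite size_tuple.
Qed.

Lemma graph_dist_le_size v p : path e v p ->
  (graph_dist e_conn v (last v p) <= size p)%N.
Proof.
move=> ep; rewrite /graph_dist; case: ex_minnP => n _; apply.
by apply/existsP; exists (in_tuple p); rewrite ep eqxx.
Qed.

Lemma graph_dist_gt0 v w : v != w -> (0 < graph_dist e_conn v w)%N.
Proof.
by have [[|x p] [_ /= <- <-]] := shortest_path v w; rewrite ?eqxx.
Qed.

Lemma graph_dist_triangle u v w :
  (graph_dist e_conn u w <= graph_dist e_conn u v + graph_dist e_conn v w)%N.
Proof.
have [p [ep lp <-]] := shortest_path u v.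
have [q [eq lq <-]] := shortest_path v w.
have := @graph_dist_le_size u (p ++ q).
by rewrite cat_path last_cat size_cat lp ep eq lq => /(_ isT).
Qed.

Lemma graph_dist_edge v w : irreflexive e -> e v w ->
  graph_dist e_conn v w = 1%N.
Proof.
move=> e_irr evw; apply/eqP; rewrite eqn_leq.
have := @graph_dist_le_size v [:: w]; rewrite /= evw => -> //=.
by apply: graph_dist_gt0; apply: contraTneq evw => ->; rewrite e_irr.
Qed.

Lemma connected_graph_neighbor v : (1 < #|V|)%N -> exists w, e v w.
Proof.
rewrite (cardD1 v) ltnS => /card_gt0P[u /[!inE] /andP[uv _]].
have [[|w p] [/= ep lp _]] := shortest_path v u; first by rewrite lp eqxx in uv.
by exists w; case/andP: ep.
Qed.

End GraphDistance.

Section SymmetricEdgePolytope.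
Variables (R : realType) (V : finType) (e : rel V).

Local Notation e_ := (basis_vec R).

Lemma sym_edge_polytope_path v p : path e v p -> (0 < size p)%N ->
  sym_edge_polytope R e ((size p)%:R^-1 *: (e_ v - e_ (last v p))).
Proof.
rewrite /sym_edge_polytope; set A := [set _ | _] => ep p0.
have [K0 KD KZ] := cone_hull_convex_cone (homogenize A).
apply/conv_hull_homogenize.
suff /(KZ (size p)%:R^-1) : cone_hull (homogenize A)
    (e_ v - e_ (last v p), (size p)%:R).
  rewrite invr_ge0 ler0n => /(_ isT); congr (cone_hull _ (_, _)).
  by rewrite /= /GRing.scale /= mulVf // pnatr_eq0 -lt0n.
elim: p v ep {p0} => [v _|w p IH v /= /andP[evw /IH Kp]].
  by rewrite subrr.
have -> : (e_ v - e_ (last w p), (size p).+1%:R) =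
    (e_ v - e_ w, 1) + (e_ w - e_ (last w p), (size p)%:R) :> _ * R^o.
  by congr pair; rewrite /= ?addrA ?subrK // -nat1r.
apply: KD => //; apply: sub_gen_smallest; exists (e_ v - e_ w) => //.
by exists v, w; split; [|left].
Qed.

Lemma sym_edge_polytopeE (e_conn : connected_graph e) :
  symmetric e -> irreflexive e -> (1 < #|V|)%N ->
  sym_edge_polytope R e =
  KR_polytope [set: V] (fun v w => (graph_dist e_conn v w)%:R).
Proof.
move=> e_sym e_irr V_gt1; pose d v w : R := (graph_dist e_conn v w)%:R.
rewrite -/d; apply/seteqP; split.
  apply: smallest_sub; first exact: KR_polytope_convex.
  have edge v w : e v w -> KR_polytope [set: V] d (e_ v - e_ w).
    move=> evw; have : KR_polytope [set: V] d (molecule d v w).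
      by apply: KR_polytope_molecule; rewrite inE.
    by rewrite /molecule /d graph_dist_edge // invr1 scale1r.
  by move=> _ [v [w [evw [|] ->]]]; apply: edge; rewrite // e_sym.
apply: KR_polytope_sub => [|v w _ _]; first exact: conv_hull_convex.
have [<-|vw] := eqVneq v w.
  have [u evu] := connected_graph_neighbor e_conn v V_gt1.
  have := @sym_edge_polytope_path v [:: u; v].
  by rewrite /= evu e_sym evu molecule_id subrr scaler0; apply.
have [p [ep lp sp]] := shortest_path e_conn v w.
rewrite /molecule /d -sp -lp; apply: sym_edge_polytope_path => //.
by rewrite sp graph_dist_gt0.
Qed.

End SymmetricEdgePolytope.

Theorem theorem2p5 (R : realType) (V : finType) (e : rel V)
    (e_sym : symmetric e) (e_irr : irreflexive e)
    (e_conn : connected_graph e) (V_gt1 : (1 < #|V|)%N)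
    (V1 : {set V}) (V1_gt0 : (0 < #|V1|)%N) :
  [set x | sym_edge_polytope R e x /\ forall i : V, i \notin V1 -> x i = 0] =
  KR_polytope V1 (fun i j => (graph_dist e_conn i j)%:R : R).
Proof.
rewrite (sym_edge_polytopeE R e_conn) //; apply: KR_polytope_section => //.
- by move=> i j ij; rewrite ltr0n graph_dist_gt0.
- by move=> i j k; rewrite -natrD ler_nat graph_dist_triangle.
Qed.
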